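(* Let $\kappa$ be an infinite cardinal, let $\varphi : \kappa \rightarrow \mathbb{Z}_+$ be a function, and let $G = \prod_{i \in \kappa} S_{\varphi(i)}$, where $S_{\varphi(i)} = \mathrm{Sym}(\{1, 2, \ldots, \varphi(i)\})$. Suppose that $|\{i\in\kappa : \varphi(i) \geq l\}| = \kappa$ for each $l \in \mathbb{Z}_+$. Then $G$ contains a free subgroup of rank $2^\kappa$ that is dense with respect to the product topology resulting from putting the discrete topology on each $S_{\varphi(i)}$. In particular, $G$ is almost $2^\kappa$-free (with respect to this topology).
   Context: $\mathbb{Z}_+$ is the set of positive integers and $\mathrm{Sym}(X)$ is the group of all permutations of $X$. For a cardinal $\lambda>0$ and a group $G$, let $G_\lambda$ denote the set of $\lambda$-tuples $(g_i)_{i\in\lambda}\in G^\lambda$ that freely generate a free subgroup of $G$, i.e. such that no nontrivial reduced group word in the indexed variables $(x_i)_{i\in\lambda}$ evaluates to $1$ at $(g_i)_{i\in\lambda}$ (equivalently, the homomorphism from the free group on $\{x_i\}_{i\in\lambda}$ to $G$ sending $x_i\mapsto g_i$ is injective). An infinite topological group $G$ is called almost $\lambda$-free if $G_\lambda$ is dense in $G^\lambda$ with the product topology. *)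

(* Defs.v *)
From HB Require Import structures.
From mathcomp Require Import all_boot fingroup perm.
From mathcomp Require Import boolp classical_sets functions cardinality filter.
From mathcomp Require Import topology.

Set Implicit Arguments.
Unset Strict Implicit.
Unset Printing Implicit Defensive.

Local Open Scope classical_set_scope.
Local Open Scope card_scope.
Local Open Scope group_scope.

(* The multiplicative, possibly non-commutative analogue of
   [topologicalZmodType]. *)
HB.mixin Record isTopologicalGroup G & Topological G & monoid.Group G := {
  mulg_continuous : continuous (fun x : G * G => x.1 * x.2) ;
  invg_continuous : continuous (fun x : G => x^-1)
}.

#[short(type="topologicalGroupType")]
HB.structure Definition TopologicalGroup :=
  {G of Topological G & monoid.Group G & isTopologicalGroup G}.

Section DiscreteGroup.
Variable T : groupType.
Local Notation D := (discrete_topology T).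

HB.instance Definition _ := isGroup.Build D
  (@mulgA T) (@mul1g T) (@mulg1 T) (@mulVg T) (@mulgV T).

Let discrete_mulg_continuous : continuous (fun x : D * D => x.1 * x.2).
Proof.
move=> [x y]; apply/discrete_cvg.
exists ([set x], [set y]); first by split; exact: discrete_set1.
by move=> [a b] /= [-> ->].
Qed.

Let discrete_invg_continuous : continuous (fun x : D => x^-1).
Proof.
by move=> x; apply/discrete_cvg; apply: (@filterS _ (nbhs x) _ [set x] _ _ (discrete_set1 x)) => a /= ->.
Qed.

HB.instance Definition _ := isTopologicalGroup.Build D
  discrete_mulg_continuous discrete_invg_continuous.

End DiscreteGroup.

Section ProductGroup.
Variables (I : Type) (T : I -> topologicalGroupType).
Local Notation P := (prod_topology T).

Definition prod_one : P := fun=> 1.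
Definition prod_inv (x : P) : P := fun i => (x i)^-1.
Definition prod_mul (x y : P) : P := fun i => x i * y i.

Let prod_mulgA : associative prod_mul.
Proof.
by move=> x y z; apply: functional_extensionality_dep => i; exact: mulgA.
Qed.

Let prod_mul1g : left_id prod_one prod_mul.
Proof.
by move=> x; apply: functional_extensionality_dep => i; exact: mul1g.
Qed.

Let prod_mulg1 : right_id prod_one prod_mul.
Proof.
by move=> x; apply: functional_extensionality_dep => i; exact: mulg1.
Qed.

Let prod_mulVg : left_inverse prod_one prod_inv prod_mul.
Proof.
by move=> x; apply: functional_extensionality_dep => i; exact: mulVg.
Qed.

Let prod_mulgV : right_inverse prod_one prod_inv prod_mul.
Proof.
by move=> x; apply: functional_extensionality_dep => i; exact: mulgV.
Qed.

HB.instance Definition _ := isGroup.Build P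
  prod_mulgA prod_mul1g prod_mulg1 prod_mulVg prod_mulgV.

Let prod_continuous (X : topologicalType) (f : X -> P) :
  (forall i, continuous (fun x => f x i)) -> continuous f.
Proof.
move=> fc x; apply/cvg_sup => i U [V [[W oW <-] Wfx WU]].
apply: filterS WU _; apply: (fc i x).
by apply: open_nbhs_nbhs; split.
Qed.

Let eval_continuous i : continuous (fun x : P => x i).
Proof.
exact: (@proj_continuous {classic I} T).
Qed.

Let prod_mulg_continuous : continuous (fun x : P * P => x.1 * x.2).
Proof.
apply: prod_continuous => i x /=.
apply: (@continuous_comp _ _ _ (fun y : P * P => (y.1 i, y.2 i))
  (fun y : T i * T i => y.1 * y.2)); last exact: mulg_continuous.
apply: cvg_pair => /=.
  apply: (@continuous_comp _ _ _ fst (fun y : P => y i)); first exact: cvg_fst.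
  exact: eval_continuous.
apply: (@continuous_comp _ _ _ snd (fun y : P => y i)); first exact: cvg_snd.
exact: eval_continuous.
Qed.

Let prod_invg_continuous : continuous (fun x : P => x^-1).
Proof.
apply: prod_continuous => i x /=.
apply: (@continuous_comp _ _ _ (fun y : P => y i) (fun y : T i => y^-1)).
  exact: eval_continuous.
exact: invg_continuous.
Qed.

HB.instance Definition _ := isTopologicalGroup.Build P
  prod_mulg_continuous prod_invg_continuous.

End ProductGroup.

Section FreeFamilies.
Variables (L : Type) (G : groupType).

(* The letter (a, true) stands for x_a and (a, false) for x_a^-1. *)
Definition word_eval (g : L -> G) (w : seq (L * bool)) : G :=
  \prod_(l <- w) (if l.2 then g l.1 else (g l.1)^-1).

Definition reduced_word (w : seq (L * bool)) : bool :=
  sorted (fun l m => ~~ `[< l.1 = m.1 /\ l.2 <> m.2 >]) w.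

(* As a set of families, this is the set of L-tuples freely generating a free
   subgroup of G. *)
Definition freely_generating : set (L -> G) :=
  [set g | forall w, reduced_word w -> w <> [::] -> word_eval g w <> 1].

Definition generated_subgroup (A : set G) : set G :=
  smallest (fun H : set G => group_closed (mem H)) A.

Definition free_subgroup_of_rank (H : set G) : Prop :=
  exists2 g, freely_generating g & H = generated_subgroup (range g).

End FreeFamilies.
Arguments freely_generating L G : clear implicits.
Arguments free_subgroup_of_rank L [G] H.

(* Cardinals are given by types: an L-indexed family is a |L|-tuple, and
   2 ^ |K| is the cardinal of the type K -> bool. *)
Definition almost_free (L : Type) (G : topologicalGroupType) : Prop :=
  infinite_set [set: G] /\
  dense (freely_generating L G : set {ptws L -> G}).

(* 'S_n permutes {0, .., n-1} instead of {1, .., n}. *)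
Definition sym_product (K : Type) (phi : K -> nat) : topologicalGroupType :=
  prod_topology (fun i => discrete_topology 'S_(phi i)).

(* Main.v *)
(* A family g indexed by 2^K such that every nonempty reduced word in it is
   nontrivial at infinitely many coordinates stays free when each member is
   changed at finitely many coordinates; as open sets only constrain finitely
   many coordinates, this yields both density claims.

   For such a g, a finite sequence ks in K maps the indices x : K -> bool to the
   countable alphabet [seq bool], by restriction to ks, and some ks separates
   the letters of a given word.  Each reduced word v over [seq bool] gets its
   own path of points of nat, along which the letters of v are to move.  At a
   coordinate i, for every v whose path lies below phi i, we pick a ks, and let
   g x act on the path of v as the letter (x restricted to ks).  The paths being
   disjoint and the words reduced, these partial injections extend to
   permutations.  As the set of i with phi i > N and the set of finite sequences
   in K have cardinality |K|, each ks can be picked for each v at infinitely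
   many i. *)
Require Import Defs.
From mathcomp Require Import all_boot fingroup perm.
From mathcomp Require Import boolp classical_sets functions cardinality.
From mathcomp Require Import topology.

Set Implicit Arguments.
Unset Strict Implicit.
Unset Printing Implicit Defensive.

Local Open Scope classical_set_scope.
Local Open Scope card_scope.

(** * Comparability of cardinals *)

Lemma card_le_injP T (U : pointedType) (A : set T) (B : set U) :
  A #<= B <-> exists2 f : T -> U, set_fun A B f & set_inj A f.
Proof. by rewrite -injfunPex; split=> [|?]; [move/pcard_leP|apply/pcard_leP]. Qed.

(** By Zorn, take a maximal partial injection [G] from [A] to [B]. If it is neither total on [A] nor
    onto [B], a pair of missed points enlarges it. *)
Lemma card_le_total T U (A : set T) (B : set U) : (A #<= B) || (B #<= A).
Proof.
elim/Ppointed: T => T in A *.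
  by rewrite (_ : A = set0) ?card_ge0 ?emptyE_subdef.
elim/Ppointed: U => U in B *.
  by rewrite (_ : B = set0) ?card_ge0 ?orbT ?emptyE_subdef.
pose P (G : set (T * U)) := [/\ G `<=` A `*` B,
  forall x y y', G (x, y) -> G (x, y') -> y = y' &
  forall x x' y, G (x, y) -> G (x', y) -> x = x'].
have [F FP Ftot|G [[GAB Gfun Ginj] Gmax]] := @Zorn_bigcup _ P.
  have join X Y : F X -> F Y -> exists Z, [/\ F Z, X `<=` Z & Y `<=` Z].
    by move=> FX FY; have [XY|YX] := Ftot _ _ FX FY; [exists Y|exists X]; split=> // ?.
  split=> [xy [X /FP[XAB _ _] /XAB //]|x y y' [X FX Xx] [Y FY Yx]|
      x x' y [X FX Xx] [Y FY Yx]]; have [Z [/FP[_ Zf Zi] XZ YZ]] := join _ _ FX FY.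
    exact: Zf (XZ _ Xx) (YZ _ Yx).
  exact: Zi (XZ _ Xx) (YZ _ Yx).
have [domA|/existsNP[a /not_implyP[Aa Na]]] :=
    pselect (forall a, A a -> exists b, G (a, b)).
  apply/orP; left; apply/card_le_injP.
  have /choice[f fP] : forall a, exists b, A a -> G (a, b).
    move=> a; have [/domA[b Gb]|nA] := pselect (A a); first by exists b.
    by exists point.
  exists f; first by move=> a /fP/GAB[].
  by move=> x y /set_mem/fP Gx /set_mem/fP Gy e; apply: Ginj Gx _; rewrite e.
have [ranB|/existsNP[b /not_implyP[Bb Nb]]] :=
    pselect (forall b, B b -> exists a, G (a, b)).
  apply/orP; right; apply/card_le_injP.
  have /choice[f fP] : forall b, exists a, B b -> G (a, b).
    move=> b; have [/ranB[a' Gb]|nA] := pselect (B b); first by exists a'.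
    by exists point.
  exists f; first by move=> b /fP/GAB[].
  by move=> x y /set_mem/fP Gx /set_mem/fP Gy e; apply: Gfun Gx _; rewrite e.
have [] := Gmax (G `|` [set (a, b)]).
  split; first by apply: subsetUl.
  by move=> /(_ (a, b)) GG; apply: Na; exists b; apply: GG; right.
split=> [_ [/GAB //|->] //|x y y'|x x' y].
- move=> [Gx|/pair_equal_spec[-> ->]] [Gx'|/pair_equal_spec[e ->]] //.
  + exact: Gfun Gx Gx'.
  + by case: Na; rewrite -e; exists y.
  + by case: Na; exists y'.
- move=> [Gx|/pair_equal_spec[-> ->]] [Gx'|/pair_equal_spec[-> e]] //.
  + exact: Ginj Gx Gx'.
  + by case: Nb; rewrite -e; exists x.
  + by case: Nb; exists x'.
Qed.

(** * Embedding the square of an infinite set, and its finite sequences, into the set *)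

Section InfiniteSquare.
Variable K : pointedType.
Implicit Types (G : set (K * K * K)) (A B : set K).

Let supp G := [set a | exists z, G ((a, a), z)].

(* Relations matching each pair of elements of [supp G] with elements of
   [supp G], injectively but not necessarily functionally. *)
Let pairing G := [/\ forall p q z, G (p, z) -> G (q, z) -> p = q,
  forall a b, supp G a -> supp G b -> exists z, G ((a, b), z) &
  forall a b z, G ((a, b), z) -> [/\ supp G a, supp G b & supp G z]].

Let supp_sub G G' : G `<=` G' -> supp G `<=` supp G'.
Proof. by move=> GG' a [z Gz]; exists z; exact: GG'. Qed.

Let pairing_bigcup (F : set (set (K * K * K))) :
  F `<=` pairing -> total_on F subset -> pairing (\bigcup_(G in F) G).
Proof.
move=> FP Ftot.
have join X Y : F X -> F Y -> exists Z, [/\ F Z, X `<=` Z & Y `<=` Z].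
  by move=> FX FY; have [XY|YX] := Ftot _ _ FX FY; [exists Y|exists X]; split=> // ?.
split=> [p q z [X FX Xp] [Y FY Yq]|a b [z [X FX Xa]] [t [Y FY Yb]]|a b z [X FX Xab]].
- have [Z [/FP[Zi _ _] XZ YZ]] := join _ _ FX FY.
  exact: Zi (XZ _ Xp) (YZ _ Yq).
- have [Z [FZ XZ YZ]] := join _ _ FX FY.
  have [_ Zt _] := FP _ FZ.
  have [|u Zu] := Zt a b _ (ex_intro _ t (YZ _ Yb)); first by exists z; exact: XZ.
  by exists u, Z.
- have [_ _ Xs] := FP _ FX; have [Xa Xb Xz] := Xs _ _ _ Xab.
  by split; apply: supp_sub (bigcup_sup FX) _ _.
Qed.

Let pairing_max G0 : pairing G0 ->
  exists G, [/\ pairing G, G0 `<=` G & forall G', G `<=` G' -> pairing G' -> G' `<=` G].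
Proof.
move=> G0P.
(* Joining [G0] to every relation makes the maximal one contain [G0] and settles the empty chain. *)
have [F FP Ftot|G [GP Gmax]] := @Zorn_bigcup _ [set G | pairing (G0 `|` G)].
  rewrite /= (_ : _ `|` _ = \bigcup_(G in G0 |` [set G0 `|` G | G in F]) G).
    apply: pairing_bigcup => [_ [->|[G FG <-]] //|]; first exact: FP.
    move=> _ _ [->|[X FX <-]] [->|[Y FY <-]].
    - by left.
    - by left; exact: subsetUl.
    - by right; exact: subsetUl.
    - by have [XY|YX] := Ftot _ _ FX FY; [left|right]; exact: setUS.
  rewrite bigcup_setU bigcup_set1 bigcup_image; apply/seteqP; split=> x.
    by move=> [?|[X FX Xx]]; [left|right; exists X => //; right].
  by move=> [?|[X FX [?|Xx]]]; [left|left|right; exists X].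
exists (G0 `|` G); split=> // G' GG' G'P.
have [/Gmax /=|] := pselect (G `<` G').
  have -> // : G0 `|` G' = G'.
  by apply/setUidPr => x Gx; apply: GG'; left.
move=> /not_andP[|/contrapT G'G x /G'G]; last by right.
by case=> x Gx; apply: GG'; right.
Qed.

Let pairing_fun G : pairing G -> exists p : K -> K -> K,
  [/\ forall a b, supp G a -> supp G b -> G ((a, b), p a b),
      forall a b, supp G a -> supp G b -> supp G (p a b) &
      forall a b a' b', supp G a -> supp G b -> supp G a' -> supp G b' ->
        p a b = p a' b' -> a = a' /\ b = b'].
Proof.
move=> [Gi Gt Gs].
have /choice[p pP] : forall ab : K * K, exists z,
    supp G ab.1 -> supp G ab.2 -> G (ab, z).
  move=> [a b]; have [[Ga Gb]|] := pselect (supp G a /\ supp G b).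
    by have [z Gz] := Gt _ _ Ga Gb; exists z.
  by move=> nG; exists point => Ga Gb; case: nG.
exists (fun a b => p (a, b)); split=> [a b Ga Gb|a b Ga Gb|a b a' b' Ga Gb Ga' Gb' e].
- exact: pP.
- by have [] := Gs _ _ _ (pP (a, b) Ga Gb).
- apply/pair_equal_spec; apply: Gi (pP (a, b) Ga Gb) _.
  by rewrite e; exact: pP.
Qed.

(** Pairing with the distinct tags [e 0] and [e 1] places two copies of the support disjointly
    inside it. *)
Let supp_setU G A B : infinite_set (supp G) -> pairing G ->
  A #<= supp G -> B #<= supp G -> A `|` B #<= supp G.
Proof.
move=> Ginf /pairing_fun[p [_ ps pi]].
move=> /card_le_injP[f fA fi] /card_le_injP[g gB gi].
have /infiniteP/card_le_injP[e es ei] := Ginf.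
apply/card_le_injP.
exists (fun x => if `[<A x>] then p (e 0) (f x) else p (e 1) (g x)).
  move=> x /=; case: asboolP => [Ax _|nA []//Bx]; apply: ps.
  - exact: es.
  - exact: fA.
  - exact: es.
  - exact: gB.
have e01 : e 0 <> e 1 by move=> /ei; rewrite !inE => /(_ I I).
move=> x y /set_mem ABx /set_mem ABy.
case: asboolP ABx => [Ax _|nAx []//Bx]; case: asboolP ABy => [Ay _|nAy []//By] => /pi.
- case; [exact: es|exact: fA|exact: es|exact: fA|] => _ /fi; apply; exact: mem_set.
- by case=> //; [exact: es|exact: fA|exact: es|exact: gB].
- by case=> //; [exact: es|exact: gB|exact: es|exact: fA|] => /esym.
- case; [exact: es|exact: gB|exact: es|exact: gB|] => _ /gi; apply; exact: mem_set.
Qed.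

(* Otherwise [supp G] embeds in its complement, and a copy of it there has
   room for the values of an extension of [G] to the union of the two. *)
Let pairing_max_compl G : infinite_set (supp G) -> pairing G ->
  (forall G', G `<=` G' -> pairing G' -> G' `<=` G) -> ~` supp G #<= supp G.
Proof.
move=> Ginf GP Gmax; set A := supp G in Ginf *.
have /orP[//|/card_le_injP[h hs hi]] := card_le_total (~` A) A.
have {}hi x y : A x -> A y -> h x = h y -> x = y.
  by move=> Ax Ay; apply: hi; exact: mem_set.
set B := h @` A.
have [p [pG ps pi]] := pairing_fun GP.
have /card_le_injP[r rs ri] : A `|` B #<= A.
  by apply: supp_setU => //; exact: card_image_le.
(* Pairs not covered by [G] are sent into [A] by [r] and [p], then out of [A] by [h], so new values
   never clash with old ones. *)
pose G' := G `|` [set x | [/\ (A `|` B) x.1.1, (A `|` B) x.1.2,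
  ~ (A x.1.1 /\ A x.1.2) & x.2 = h (p (r x.1.1) (r x.1.2))]].
have [Gi Gt Gs] := GP.
have hN a b : (A `|` B) a -> (A `|` B) b -> ~ A (h (p (r a) (r b))).
  by move=> ABa ABb; apply: hs; apply: ps; exact: rs.
have G'tot a b : (A `|` B) a -> (A `|` B) b -> exists z, G' ((a, b), z).
  move=> ABa ABb; have [[Aa Ab]|nA] := pselect (A a /\ A b).
    by have [z Gz] := Gt _ _ Aa Ab; exists z; left.
  by exists (h (p (r a) (r b))); right.
have suppG' : supp G' = A `|` B.
  apply/seteqP; split=> a; last by move=> ABa; exact: G'tot.
  by move=> [z [Gz|[]//]]; left; exists z.
have G'P : pairing G'.
  split; rewrite ?suppG' //.
  - move=> [a b] [c d] z [Gz|/= [Ba Bb _ ->]] [Gz'|/= [Bc Bd _ e]].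
    + exact: Gi Gz Gz'.
    + by have [_ _] := Gs _ _ _ Gz; rewrite e => /(hN _ _ Bc Bd).
    + by have [_ _] := Gs _ _ _ Gz' => /(hN _ _ Ba Bb).
    + have {}e := hi _ _ (ps _ _ (rs _ Ba) (rs _ Bb))
        (ps _ _ (rs _ Bc) (rs _ Bd)) e.
      have [eac ebd] := pi _ _ _ _ (rs _ Ba) (rs _ Bb) (rs _ Bc) (rs _ Bd) e.
      by congr pair; apply: ri => //; exact: mem_set.
  - move=> a b z [Gz|/= [ABa ABb _ ->]].
      by have [? ? ?] := Gs _ _ _ Gz; split; left.
    by split=> //; right; exists (p (r a) (r b)) => //; apply: ps; exact: rs.
have [x Ax] := infinite_setN0 Ginf.
have GG' : G' `<=` G by apply: Gmax => // ? ?; left.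
have : supp G' (h x) by rewrite suppG'; right; exists x.
by move=> /(supp_sub GG')/(hs _ Ax).
Qed.

(** A copy of the pairing of [nat] extends to a maximal pairing. Its support is infinite and at
    least as large as its complement, so all of [K] embeds in it. *)
Lemma infinite_pairing : infinite_set [set: K] -> exists p : K -> K -> K,
  forall a b c d, p a b = p c d -> a = c /\ b = d.
Proof.
move=> /infiniteP/card_le_injP[e _ ei].
have {}ei : injective e by move=> x y; apply: ei; exact: mem_set.
pose G0 : set (K * K * K) :=
  [set x | exists i j, x = ((e i, e j), e (pickle (i, j)))].
have G0s i : supp G0 (e i) by exists (e (pickle (i, i))), i, i.
have [|G [GP G0G Gmax]] := @pairing_max G0.
  split=> [[a b] [c d] z [i [j [-> -> ->]]] [i' [j' [-> -> /ei]]]||].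
  - by move=> /(pcan_inj pickleK)[-> ->].
  - move=> _ _ [_ [i [_ [-> _ _]]]] [_ [j [_ [-> _ _]]]].
    by exists (e (pickle (i, j))), i, j.
  - by move=> _ _ _ [i [j [-> -> ->]]].
have Ginf : infinite_set (supp G).
  apply/infiniteP/card_le_injP; exists e => [i _|x y _ _ /ei//].
  exact: supp_sub (G0s i).
have : supp G `|` ~` supp G #<= supp G.
  by apply: supp_setU => //; exact: pairing_max_compl.
rewrite setUv => /card_le_injP[r rs ri].
have [p [_ _ pi]] := pairing_fun GP.
exists (fun a b => p (r a) (r b)) => a b c d.
have {}rs x : supp G (r x) by exact: rs.
move=> /(pi _ _ _ _ (rs a) (rs b) (rs c) (rs d))[rac rbd].
by split; apply: ri => //; exact: mem_set.
Qed.

End InfiniteSquare.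

Lemma infinite_seq_inj (K : Type) :
  infinite_set [set: K] -> exists c : seq K * nat -> K, injective c.
Proof.
elim/Ppointed: K => K Kinf; first by case: Kinf; rewrite emptyE_subdef.
have [p pi] := infinite_pairing Kinf.
have /infiniteP/card_le_injP[e _ ei] := Kinf.
have {}ei : injective e by move=> x y; apply: ei; exact: mem_set.
(* The length is recorded because the folded code alone does not show where the sequence ends. *)
exists (fun sn => p (e sn.2) (p (e (size sn.1)) (foldr p (e 0) sn.1))).
move=> [s n] [t m] /= /pi[/ei -> /pi[/ei]]; elim: s t => [|a s IHs] [|b t] //=.
by move=> [/IHs{}IHs] /pi[-> /IHs[->]].
Qed.

(** * Permutations moving points along paths that spell reduced words *)

Lemma perm_extends (T : finType) (R : T -> T -> Prop) :
  (forall x y z, R x y -> R x z -> y = z) ->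
  (forall x y z, R x z -> R y z -> x = y) ->
  exists s : {perm T}, forall x y, R x y -> s x = y.
Proof.
move=> Rfun Rinj; pose D := [pred x | `[< exists y, R x y >]].
have /choice[f fP] : forall x, exists y, x \in D -> R x y.
  move=> x; have [/asboolP[y xy]|] := boolP (x \in D); first by exists y.
  by exists x.
have fi : {in D &, injective f}.
  by move=> x y /fP Rx /fP Ry e; apply: Rinj Rx _; rewrite e.
pose E := [seq f x | x in D].
(* The complements of domain and image have equal size, so matching their enumerations completes the
   injection. *)
have sDE : size (enum [predC D]) = size (enum [predC E]).
  rewrite -!cardE; apply/eqP; rewrite -(eqn_add2l #|D|) cardC.
  by rewrite -(card_in_image fi) cardC.
pose s x := if x \in D then f x else nth x (enum [predC E]) (index x (enum [predC D])).
have sE x : x \notin D -> s x \notin E.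
  move=> xD; rewrite /s (negPf xD).
  have : nth x (enum [predC E]) (index x (enum [predC D])) \in enum [predC E].
    by rewrite mem_nth // -sDE index_mem mem_enum inE.
  by rewrite mem_enum inE.
have sD x : x \in D -> s x \in E.
  by move=> xD; rewrite /s xD; exact: fintype.image_f.
have si : injective s.
  move=> x y; case: (boolP (x \in D)) (sD x) (sE x) => xD sDx sEx;
      case: (boolP (y \in D)) (sD y) (sE y) => yD sDy sEy e.
  - by move: e; rewrite /s xD yD; exact: fi.
  - by move: (sEy isT); rewrite -e sDx.
  - by move: (sEx isT); rewrite e sDy.
  - have xC : x \in enum [predC D] by rewrite mem_enum inE.
    have yC : y \in enum [predC D] by rewrite mem_enum inE.
    move: e; rewrite /s (negPf xD) (negPf yD) (set_nth_default x y) -?sDE ?index_mem //.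
    move/eqP; rewrite nth_uniq ?enum_uniq -?sDE ?index_mem // => /eqP.
    exact: index_inj.
exists (perm si) => x y xy; rewrite permE /s.
have xD : x \in D by apply/asboolP; exists y.
by rewrite xD; apply: Rfun xy; exact: fP.
Qed.

Section WordStep.
Variable L : Type.
Implicit Types (v : seq (L * bool)) (y : L).

(* The edges labelled [y] of the path with vertices [0, .., size v] spelling
   the word [v]; the edge of an inverted letter is traversed backwards. *)
Definition word_step v y p q : Prop :=
  (onth v p = Some (y, true) /\ q = p.+1) \/
  (onth v q = Some (y, false) /\ p = q.+1).

Lemma reduced_word_onth v y b t : reduced_word v ->
  onth v t = Some (y, b) -> onth v t.+1 <> Some (y, ~~ b).
Proof.
elim: v t => // l v IHv t lv; have vr : reduced_word v by exact: path_sorted lv.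
case: t => [[lE]|t]; last exact: IHv.
case: v {IHv vr} lv => //= m v /andP[/asboolP lm _] [mE]; apply: lm.
by rewrite lE mE; case: b {lE mE}.
Qed.

(** Two distinct edges labelled [y] leaving one vertex would come from adjacent letters [y] and its
    inverse, which a reduced word excludes. *)
Lemma word_step_fun v y p q r :
  reduced_word v -> word_step v y p q -> word_step v y p r -> q = r.
Proof.
move=> vr [[vp ->]|[vq pq]] [[vp' ->]|[vr' pr]] //.
- by rewrite pr in vp; case: (reduced_word_onth vr vr').
- by rewrite pq in vp'; case: (reduced_word_onth vr vq).
- by apply: succn_inj; rewrite -pq.
Qed.

Lemma word_step_inj v y p q r :
  reduced_word v -> word_step v y p r -> word_step v y q r -> p = q.
Proof.
move=> vr [[vp rp]|[vr' ->]] [[vq rq]|[vr'' ->]] //.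
- by apply: succn_inj; rewrite -rp.
- by rewrite rp in vr''; case: (reduced_word_onth vr vp).
- by rewrite rq in vr'; case: (reduced_word_onth vr vq).
Qed.

(** Products of permutations act from left to right, so after a prefix [u] is read the point stands
    at vertex [size u]. *)
Lemma word_eval_path (T : finType) (s : L -> {perm T}) (pos : nat -> T) v :
  (forall y p q, word_step v y p q -> s y (pos p) = pos q) ->
  (word_eval s v : {perm T}) (pos 0) = pos (size v).
Proof.
move=> sP; suff path u w : v = u ++ w ->
    (word_eval s w : {perm T}) (pos (size u)) = pos (size v).
  exact: (path [::]).
elim: w u => [|[y b] w IHw] u vE.
  by rewrite /word_eval big_nil perm1 vE cats0.
rewrite /word_eval big_cons permM -/(word_eval s w).
have /IHw : v = rcons u (y, b) ++ w by rewrite cat_rcons.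
rewrite size_rcons => <-; congr (_ _).
have vu : onth v (size u) = Some (y, b) by rewrite vE onth_cat ltnn subnn.
case: b vu {vE} => vu /=.
  by apply: sP; left.
by apply: (canLR (permK _)); apply: esym; apply: sP; right.
Qed.

End WordStep.

Lemma word_step_size (L : Type) (v : seq (L * bool)) y p q :
  word_step v y p q -> (p <= size v)%N /\ (q <= size v)%N.
Proof.
move=> [[vp ->]|[vq ->]].
  have pv : (p < size v)%N by rewrite -onthTE vp.
  by split=> //; exact: ltnW.
have qv : (q < size v)%N by rewrite -onthTE vq.
by split=> //; exact: ltnW.
Qed.

(* One path for each reduced word [v], on the vertices [pickle (v, t)], so that
   the paths of different words are disjoint. *)
Lemma perm_family_avoiding (X : Type) (L : countType)
    (a : seq (L * bool) -> X -> L) (n : nat) :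
  exists s : X -> 'S_n, forall w v, v = [seq (a v l.1, l.2) | l <- w] ->
    reduced_word v -> v <> [::] ->
    (forall t, (t <= size v)%N -> (pickle (v, t) < n)%N) ->
    word_eval s w <> 1%g.
Proof.
(* [R x] gathers the edges of all paths that [x] must follow; disjointness of paths reduces both
   conditions on it to a single word. *)
pose R x (p q : 'I_n) := exists v (t u : nat), [/\ reduced_word v,
  p = pickle (v, t) :> nat, q = pickle (v, u) :> nat & word_step v (a v x) t u].
have pickle_pair (v v' : seq (L * bool)) (t t' : nat) :
    pickle (v, t) = pickle (v', t') -> v = v' /\ t = t'.
  by move/(pcan_inj pickleK) => [].
have /choice[s sP] : forall x, exists s : 'S_n, forall p q, R x p q -> s p = q.
  move=> x; apply: perm_extends => p q r.
    move=> [v [t [u [vr pE qE vs]]]] [v' [t' [u' [_ pE' rE vs']]]].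
    move: pE'; rewrite pE => /pickle_pair[vv' tt']; rewrite -{}vv' -{}tt' in rE vs'.
    by apply: val_inj; rewrite /= qE rE (word_step_fun vr vs vs').
  move=> [v [t [u [vr pE rE vs]]]] [v' [t' [u' [_ qE rE' vs']]]].
  move: rE'; rewrite rE => /pickle_pair[vv' uu']; rewrite -{}vv' -{}uu' in qE vs'.
  by apply: val_inj; rewrite /= pE qE (word_step_inj vr vs vs').
exists s => w v vw vr v0 vn.
have n0 := leq_ltn_trans (leq0n _) (vn 0 (leq0n _)).
(* The default is never reached on the path, by [vn]. *)
pose pos (t : nat) : 'I_n := insubd (Ordinal n0) (pickle (v, t)).
have posE (t : nat) : (t <= size v)%N -> pos t = pickle (v, t) :> nat.
  by move=> /vn tn; rewrite /pos insubdK.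
move=> /(congr1 (fun u : 'S_n => u (pos 0))); rewrite perm1.
have sw : size w = size v by rewrite vw size_map.
rewrite (@word_eval_path _ _ s pos) => [|x p q wpq].
  rewrite sw => /(congr1 val); rewrite /= posE // posE // => /pickle_pair[_].
  by move=> /size0nil.
have vpq : word_step v (a v x) p q.
  by case: wpq => -[wp ->]; [left|right]; rewrite {1}vw onth_map wp.
have [pv qv] := word_step_size vpq.
by apply: sP; exists v, p, q; split; rewrite ?posE.
Qed.

(** * Neighbourhoods in products, and separation of letters *)

Lemma prod_topology_nbhs (I : eqType) (T : I -> topologicalType)
    (x : prod_topology T) (U : set (prod_topology T)) :
  nbhs x U -> exists (F : seq I) (V : forall i, set (T i)),
    (forall i, nbhs (x i) (V i)) /\
    (forall y : prod_topology T, (forall i, i \in F -> V i (y i)) -> U y).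
Proof.
(* It suffices that this filter converges to [x], which is tested on one coordinate at a time since
   the topology is a supremum. *)
pose G : set_system (prod_topology T) := fun U =>
  exists (F : seq I) (V : forall i, set (T i)),
    (forall i, nbhs (x i) (V i)) /\
    (forall y : prod_topology T, (forall i, i \in F -> V i (y i)) -> U y).
have GF : Filter G.
  split.
  - by exists [::], (fun=> setT); split=> // i; exact: filterT.
  - move=> A B [F [V [Vx VA]]] [F' [V' [Vx' VB]]].
    exists (F ++ F'), (fun i => V i `&` V' i); split=> [i|y yV].
      exact: filterI.
    split; [apply: VA => i iF|apply: VB => i iF].
      by have [] := yV i; rewrite ?mem_cat ?iF.
    by have [] := yV i; rewrite ?mem_cat ?iF ?orbT.
  - move=> A B AB [F [V [Vx VA]]]; exists F, V; split=> // y /VA; exact: AB.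
suff Gx : G --> x by exact: Gx.
apply/cvg_sup => i A [B [[W oW <-] Wx WA]].
exists [:: i], (@dfwith I (fun i => set (T i)) (fun=> setT) i W); split=> [j|y yV].
  by case: dfwithP => [|j' _]; [exact: open_nbhs_nbhs|exact: filterT].
by apply: WA; have := yV i (mem_head _ _); rewrite dfwith_in.
Qed.

Lemma freely_generating_inj (L : Type) (G : groupType) (g : L -> G) :
  freely_generating L G g -> injective g.
Proof.
move=> gP x y gxy; apply: contrapT => xy.
have /gP [] // : reduced_word [:: (x, true); (y, false)].
  by rewrite /= andbT; apply/asboolP => -[].
by rewrite /word_eval !big_cons big_nil /= gxy mulg1 mulgV.
Qed.

Lemma separating_seq (X : eqType) (w : seq ((X -> bool) * bool)) :
  reduced_word w -> exists ks : seq X,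
    reduced_word [seq ([seq l.1 k | k <- ks], l.2) | l <- w].
Proof.
move=> wr.
(* [None] serves equal letters, as [X] may be empty. *)
have /choice[d dP] : forall xy : (X -> bool) * (X -> bool), exists k : option X,
    xy.1 <> xy.2 -> exists2 k0, k = Some k0 & xy.1 k0 <> xy.2 k0.
  move=> [x y] /=; have [->|/eqP xy] := eqVneq x y; first by exists None.
  suff /existsNP[k xyk] : ~ (forall k, x k = y k) by exists (Some k) => _; exists k.
  by move=> e; apply: xy; apply/funext.
(* One separating coordinate for each pair of distinct letters of [w] is enough. *)
exists (pmap id [seq d (l.1, m.1) | l <- w, m <- w]).
apply: (homo_sorted_in (P := mem w) _ (allss w) wr) => l m lw mw /asboolP lm.
apply/asboolP => /= -[e lm2]; apply: lm; split=> //; apply: contrapT => lm1.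
have [k dk []] := dP (_, _) lm1.
move/eq_in_map: e; apply; rewrite mem_pmap map_id -dk.
exact: allpairs_f.
Qed.

(** * Free families and density in the product of symmetric groups *)

Section SymProduct.
Variables (K : pointedType) (phi : K -> nat).
Hypothesis K_infinite : infinite_set [set: K].
Hypothesis phi_card : forall l, (0 < l)%N ->
  [set i | (l <= phi i)%N] #= [set: K].

(** The points [h (c (ks, n))], for varying [n], are infinitely many coordinates to label with [ks],
    so some lie outside [F]. *)
Lemma infinite_labels : exists lab : nat -> K -> seq K,
  forall N (ks F : seq K), exists i, [/\ i \notin F, (N < phi i)%N & lab N i = ks].
Proof.
have [c ci] := infinite_seq_inj K_infinite.
suff H N : exists f : K -> seq K, forall ks (F : seq K),
    exists i, [/\ i \notin F, (N < phi i)%N & f i = ks].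
  by have /choice[lab labP] := H; exists lab.
have := phi_card (ltn0Sn N); rewrite card_eq_le => /andP[_ /card_le_injP[h hN hi]].
have {}hi : injective h by move=> x y; apply: hi; exact: mem_set.
have {}hN k : (N < phi (h k))%N by exact: hN.
have /choice[f fP] : forall i, exists ks, forall ks' n, i = h (c (ks', n)) -> ks = ks'.
  move=> i; have [[ks [n ->]]|nE] := pselect (exists ks n, i = h (c (ks, n))).
    by exists ks => ks' n' /hi/ci[].
  by exists [::] => ks' n' iE; case: nE; exists ks', n'.
exists f => ks F.
have [n nF] : exists n, h (c (ks, n)) \notin F.
  apply/not_existsP => allF.
  pose s := [seq h (c (ks, n)) | n <- iota 0 (size F).+1].
  have : (size s <= size F)%N.
    apply: uniq_leq_size => [|_ /mapP[n _ ->]].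
      by rewrite map_inj_uniq ?iota_uniq // => n m /hi/ci[].
    by apply/negPn/negP; exact: allF.
  by rewrite size_map size_iota ltnn.
by exists (h (c (ks, n))); split=> //; exact: fP erefl.
Qed.

Lemma word_eval_coord (L : Type) (g : L -> sym_product phi) w i :
  word_eval g w i = word_eval (fun x => g x i : 'S_(phi i)) w.
Proof.
rewrite /word_eval; elim: w => [|[x b] w IHw]; first by rewrite !big_nil.
by rewrite !big_cons /= -IHw; case: b.
Qed.

Lemma cofinitely_free_family : exists g : (K -> bool) -> sym_product phi,
  forall w (F : seq K), reduced_word w -> w <> [::] ->
    exists2 i, i \notin F & word_eval g w i <> 1%g.
Proof.
have [lab labP] := infinite_labels.
(* If [N v < phi i], the whole path of [v] lies among the points permuted at [i]. *)
pose N (v : seq (seq bool * bool)) := \max_(t < (size v).+1) pickle (v, val t).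
have sP i := cid (@perm_family_avoiding (K -> bool) _
  (fun v x => [seq x k | k <- lab (N v) i]) (phi i)).
exists (fun x i => sval (sP i) x) => w F wr w0.
have [ks ksw] := separating_seq wr; set v := [seq _ | _ <- w] in ksw.
have [i [iF Ni labi]] := labP (N v) ks F.
exists i => //; rewrite word_eval_coord.
apply: (svalP (sP i) w v) => //.
- by rewrite labi.
- by move/(congr1 size)/eqP; rewrite size_map => /nilP.
- move=> t tv; apply: leq_ltn_trans Ni.
  have := leq_bigmax (F := fun u : 'I_(size v).+1 => pickle (v, val u))
    (@Ordinal (size v).+1 t tv); exact.
Qed.

(** The exceptional sets of the finitely many letters of [w] have a finite union, outside which [g]
    and [h] give [w] the same value. *)
Lemma freely_generating_cofinite (L : eqType) (g h : L -> sym_product phi) :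
  (forall w (F : seq K), reduced_word w -> w <> [::] ->
    exists2 i, i \notin F & word_eval g w i <> 1%g) ->
  (forall x, exists F : seq K, forall i, i \notin F -> h x i = g x i) ->
  freely_generating L (sym_product phi) h.
Proof.
move=> gP /choice[F FP] w wr w0 hw.
have [i iF] := gP w (flatten [seq F l.1 | l <- w]) wr w0; apply.
suff <- : word_eval h w i = word_eval g w i by rewrite hw.
rewrite !word_eval_coord /word_eval; apply: eq_big_seq => l lw.
rewrite FP //; apply: contra iF => iFl.
by apply/flattenP; exists (F l.1) => //; exact: (map_f (fun l => F l.1)).
Qed.

Lemma sym_product_nbhs (f : sym_product phi) U : nbhs f U ->
  exists F : seq K, forall h : sym_product phi,
    (forall i, i \in F -> h i = f i) -> U h.
Proof.
move=> /prod_topology_nbhs[F [V [Vf VU]]]; exists F => h hf.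
by apply: VU => i /hf ->; exact: nbhs_singleton.
Qed.

(** Only finitely many indices are constrained, so the union of their finite coordinate sets serves
    for all indices at once. *)
Lemma ptws_sym_product_nbhs (L : eqType) (f : {ptws L -> sym_product phi}) U :
  nbhs f U -> exists F : seq K, forall h : L -> sym_product phi,
    (forall x i, i \in F -> h x i = f x i) -> U h.
Proof.
move=> /prod_topology_nbhs[F [V [Vf VU]]].
have /choice[S SP] := fun x => sym_product_nbhs (Vf x).
exists (flatten [seq S x | x <- F]) => h hf; apply: VU => x xF; apply: SP => i iS.
by apply: hf; apply/flattenP; exists (S x) => //; exact: map_f.
Qed.

(** The restriction of [f] to [F] is a finite list of elements of countable types, hence coded by
    some [n]. *)
Lemma finite_patterns : exists D : seq K -> nat -> sym_product phi,
  forall F (f : sym_product phi), exists n, forall i, i \in F -> D F n i = f i.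
Proof.
pose D (F : seq K) n : sym_product phi := fun i =>
  odflt (1%g : 'S_(phi i)) (unpickle (nth 0 (odflt [::] (unpickle n)) (index i F))).
exists D => F f; exists (pickle [seq pickle (f i : 'S_(phi i)) | i <- F]) => i iF.
by rewrite /D pickleK /= (nth_map i) ?index_mem // nth_index // pickleK.
Qed.

Lemma infinite_sym_product : infinite_set [set: sym_product phi].
Proof.
have [g gP] := cofinitely_free_family.
have gi : injective g.
  by apply/freely_generating_inj/(freely_generating_cofinite gP) => x; exists [::].
(* Indicator functions of points embed [K] into the index set. *)
pose h k := g (fun k' => k' == k).
have hi : injective h.
  by move=> k k' /gi/(congr1 (fun x => x k)); rewrite eqxx => /esym/eqP.
move=> /(sub_finite_set (@subsetT _ (range h))).
have hK : range h #= [set: K] by apply: inj_card_eq => x y _ _; exact: hi.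
by rewrite (eq_finite_set hK).
Qed.

Lemma dense_free_subgroup : exists H : set (sym_product phi),
  free_subgroup_of_rank (K -> bool) H /\ dense H.
Proof.
have [g gP] := cofinitely_free_family.
have [D DP] := finite_patterns.
have [c ci] := infinite_seq_inj K_infinite.
(* The indicator of [c (F, n)] carries the task of matching pattern [n] on [F]; every other index
   gets the empty list, which leaves [g x] unchanged. *)
have /choice[m mP] : forall x : K -> bool, exists Fn, forall Fn',
    x = (fun k => k == c Fn') -> Fn = Fn'.
  move=> x; have [[Fn ->]|nE] := pselect (exists Fn, x = fun k => k == c Fn).
    exists Fn => Fn' /(congr1 (fun x => x (c Fn))).
    by rewrite eqxx => /esym/eqP/ci.
  by exists ([::], 0) => Fn' xE; case: nE; exists Fn'.
pose h x : sym_product phi :=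
  fun i => if i \in (m x).1 then D (m x).1 (m x).2 i else g x i.
exists (generated_subgroup (range h)); split.
  exists h => //; apply: (freely_generating_cofinite gP) => x.
  by exists (m x).1 => i /negPf iF; rewrite /h iF.
move=> U [f Uf] oU.
have [F FU] := sym_product_nbhs (open_nbhs_nbhs (conj oU Uf)).
have [n nP] := DP F f.
pose x k := k == c (F, n).
have mx : m x = (F, n) by exact: mP.
exists (h x); split; last by apply: sub_smallest; [exact: subset_refl|exists x].
by apply: FU => i iF; rewrite /h mx /= iF; exact: nP.
Qed.

Lemma almost_free_sym_product : almost_free (K -> bool) (sym_product phi).
Proof.
split; first exact: infinite_sym_product.
have [g gP] := cofinitely_free_family.
move=> U [f Uf] oU.
have [F FU] := ptws_sym_product_nbhs (open_nbhs_nbhs (conj oU Uf)).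
exists (fun x i => if i \in F then f x i else g x i); split.
  by apply: FU => x i ->.
by apply: (freely_generating_cofinite gP) => x; exists F => i /negPf ->.
Qed.

End SymProduct.

Theorem theorem24 (K : Type) (phi : K -> nat)
    (K_infinite : infinite_set [set: K])
    (phi_gt0 : forall i, (0 < phi i)%N)
    (phi_card : forall l : nat, (0 < l)%N ->
       [set i | (l <= phi i)%N] #= [set: K]) :
  (exists H : set (sym_product phi),
     free_subgroup_of_rank (K -> bool) H /\ dense H) /\
  almost_free (K -> bool) (sym_product phi).
Proof.
elim/Ppointed: K => K in phi K_infinite phi_gt0 phi_card *.
  by case: K_infinite; rewrite emptyE_subdef.
by split; [exact: dense_free_subgroup|exact: almost_free_sym_product].
Qed.
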